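(* Let $p,q,r>1$, $k\in(0,1)$ and $n\in\{0,1,2,\ldots\}$. Then for any $R\in(-1,q-1]$, with $u$ defined by $1/u:=(R+1)/q$ (so $u\ge1$), $$\int_0^{K_{p,q,r}(k)}\operatorname{sn}_{p,q,r}^{qn+R}(t,k)\,dt=\frac{1}{(R+1)(1/p^*+1/u+1/r)_n}\cdot\frac{\left(w_{2,1}^{(n)}+k^qw_{2,2}^{(n)}\right)K_{p,u,r}(k^{R+1})-w_{2,1}^{(n)}E_{p,u,r}(k^{R+1})}{k^{q(n+1)}},$$ where the $2\times2$ matrix $W_n=(w_{i,j}^{(n)})_{1\le i,j\le2}$ is given by $W_0:=$ the identity matrix and $W_n:=A_{n-1}A_{n-2}\cdots A_1A_0$ for $n\ge1$, with $$A_m:=\begin{pmatrix} m+\frac1u+\frac1{p^*}+\left(m+\frac1u+\frac1r\right)k^q & -\frac1u-m\\ \left(m+\frac1u+\frac1{p^*}+\frac1r\right)k^q & 0\end{pmatrix}\qquad(m=0,1,2,\ldots).$$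
   Context: For $s>1$, $s^*:=s/(s-1)$. For $p,r>1$, $q\ge1$ and $k\in[0,1)$, $$K_{p,q,r}(k):=\int_0^1\frac{dt}{(1-t^q)^{1/p}(1-k^qt^q)^{1-1/r}},\qquad E_{p,q,r}(k):=\int_0^1\frac{(1-k^qt^q)^{1/r}}{(1-t^q)^{1/p}}\,dt$$ (the value $q=1$ is allowed). For $p,q,r>1$ and $k\in[0,1)$ let $H_{p,q,r}(x,k):=\int_0^x\frac{dt}{(1-t^q)^{1/p}(1-k^qt^q)^{1-1/r}}$, $x\in[0,1]$; this is an increasing bijection $[0,1]\to[0,K_{p,q,r}(k)]$, and $\operatorname{sn}_{p,q,r}(\cdot,k):[0,K_{p,q,r}(k)]\to[0,1]$ denotes its inverse. A superscript on $\operatorname{sn}$ denotes a power. $(\zeta)_0:=1$, $(\zeta)_n:=\zeta(\zeta+1)\cdots(\zeta+n-1)$ for $n\ge1$. *)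

(* Defs.v *)
From mathcomp Require Import all_boot all_order all_algebra.
From mathcomp Require Import all_classical all_reals all_analysis.

Set Implicit Arguments.
Unset Strict Implicit.
Unset Printing Implicit Defensive.

Import Order.TTheory GRing.Theory Num.Theory.

Local Open Scope classical_set_scope.
Local Open Scope ring_scope.

(* The integrals below are Lebesgue integrals. The integrands are unbounded
   near an endpoint; their values at the endpoints themselves (where [powR]
   uses 0 `^ a = 0 for a != 0) do not matter, as points are negligible. *)

Section generalized_elliptic.
Context {R : realType}.
Implicit Types p q r k x t s : R.

Definition conj_exponent s : R := s / (s - 1).

Definition integrandK p q r k t : R :=
  1 / ((1 - t `^ q) `^ (1 / p) * (1 - k `^ q * t `^ q) `^ (1 - 1 / r)).

Definition integrandE p q r k t : R :=
  (1 - k `^ q * t `^ q) `^ (1 / r) / (1 - t `^ q) `^ (1 / p).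

Definition ellK p q r k : R :=
  \int[@lebesgue_measure R]_(t in `[0, 1]) integrandK p q r k t.

Definition ellE p q r k : R :=
  \int[@lebesgue_measure R]_(t in `[0, 1]) integrandE p q r k t.

Definition ellH p q r x k : R :=
  \int[@lebesgue_measure R]_(t in `[0, x]) integrandK p q r k t.

(* ['pinv_d A f] is the inverse of the restriction of [f] to [A], extended by
   the default [d] outside of the image [f @` A]. *)
Definition ellsn p q r t k : R :=
  'pinv_(fun=> 0) (`[0, 1] : set R) (fun x => ellH p q r x k) t.

Definition pochhammer (z : R) (n : nat) : R := \prod_(i < n) (z + i%:R).

Definition matA p q r u k (m : nat) : 'M[R]_2 :=
  let rows :=
    [:: [:: m%:R + 1 / u + 1 / conj_exponent p + (m%:R + 1 / u + 1 / r) * k `^ q;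
            - (1 / u) - m%:R];
        [:: (m%:R + 1 / u + 1 / conj_exponent p + 1 / r) * k `^ q;
            0]] in
  \matrix_(i < 2, j < 2) nth 0 (nth [::] rows i) j.

Fixpoint matW p q r u k (n : nat) : 'M[R]_2 :=
  if n is m.+1 then matA p q r u k m *m matW p q r u k m else 1%:M.

End generalized_elliptic.

(* Main.v *)
(* Put J_m = int_0^1 x^m dy / ((1 - x)^(1/p) (1 - k^q x)^(1 - 1/r)) with
   x = y^u. The substitution t = H(y^(1/(R+1))) turns the integral of
   sn^(qn+R) into J_n / (R+1), and K_{p,u,r} = J_0, E_{p,u,r} = J_0 - k^q J_1.
   Integrating the derivative of y^(um+1) (1 - x)^(1-1/p) (1 - k^q x)^(1/r),
   which vanishes at 0 and 1, gives a three-term recurrence for the J_m; A_m is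
   its companion matrix, scaled by k^q (1/p^* + 1/u + 1/r + m). *)
Require Import Defs.
From mathcomp Require Import all_boot all_order all_algebra.
From mathcomp Require Import all_classical all_reals all_analysis.
From mathcomp Require Import measurable_realfun ring lra.

Set Implicit Arguments.
Unset Strict Implicit.
Unset Printing Implicit Defensive.

Import Order.TTheory GRing.Theory Num.Theory.
Import numFieldNormedType.Exports.

Local Open Scope classical_set_scope.
Local Open Scope ring_scope.

(** * Improper integrals *)

Section calculus.
Context {R : realType}.
Notation mu := (@lebesgue_measure R).
Implicit Types (F G f : R -> R) (a b x : R).

(** Margin of a compact exhaustion of the open interval. The shift to [n.+3] keeps it at most a
    third of the length, so every [inset] is a nondegenerate segment, already for [n = 0]. *)
Let gap a b (n : nat) : R := (b - a) / n.+3%:R.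

Let inset a b n : set R := `[a + gap a b n, b - gap a b n].

Let gap_gt0 a b n : a < b -> 0 < gap a b n.
Proof. by move=> ab; rewrite divr_gt0// subr_gt0. Qed.

Let gap_lt a b n : a < b -> a + gap a b n < b - gap a b n.
Proof.
move=> ab; have ba : 0 < b - a by rewrite subr_gt0.
have : gap a b n * 3 <= b - a.
  by rewrite mulrAC ler_pdivrMr// ler_pM2l// ler_nat.
by have := gap_gt0 n ab; lra.
Qed.

Let gap_le a b m n : a < b -> (m <= n)%N -> gap a b n <= gap a b m.
Proof.
move=> ab mn; rewrite ler_pM2l ?subr_gt0// lef_pV2 ?posrE//.
by rewrite ler_nat !ltnS.
Qed.

Let bigcup_inset a b : a < b -> \bigcup_n inset a b n = `]a, b[%classic.
Proof.
move=> ab; apply/seteqP; split=> [x [n _]|x].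
  rewrite /inset/= !in_itv/= => /andP[? ?].
  by have := gap_gt0 n ab; move=> ?; apply/andP; split; lra.
rewrite /= in_itv/= => /andP[ax xb].
(* [e] is the distance from [x] to the nearer endpoint; the Archimedean property yields a margin
   below it. *)
pose e := Num.min (x - a) (b - x).
have e0 : 0 < e by rewrite lt_min !subr_gt0 ax.
have ba : 0 < b - a by rewrite subr_gt0.
exists (Num.bound ((b - a) / e)) => //.
have : gap a b (Num.bound ((b - a) / e)) <= e.
  rewrite ler_pdivrMr// mulrC -ler_pdivrMr//.
  apply: ltW; apply: lt_le_trans (archi_boundP _) _; first by rewrite divr_ge0// ltW.
  by rewrite ler_nat -addn3 leq_addr.
rewrite /inset/= in_itv/= le_min => /andP[? ?].
by apply/andP; split; lra.
Qed.

Lemma gt0_derive_homo F f a b :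
  {within `[a, b], continuous F} ->
  {in `]a, b[, forall x, is_derive x 1 F (f x)} ->
  {in `]a, b[, forall x, 0 < f x} ->
  {in `[a, b] &, {homo F : x y / x < y}}.
Proof.
move=> cF dF f0; apply: gtr0_derive1_lt_cc => // x xab.
  by have [] := dF x xab.
by rewrite derive1E (@derive_val _ _ _ _ _ _ _ (dF x xab)) f0.
Qed.

(** Adding the two endpoints, with whatever values [f] takes there, preserves measurability. This
    accommodates integrands that blow up at the ends. *)
Lemma continuous_oo_measurable_fun f a b : {in `]a, b[, continuous f} ->
  measurable_fun `[a, b]%classic f.
Proof.
move=> cf; apply/measurable_fun_itv_bndo_bndcP/measurable_fun_itv_obnd_cbndP.
by apply: open_continuous_measurable_fun => // x /set_mem; exact: cf.
Qed.

(* Both sides may be improper integrals, or infinite: the identity is obtained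
   as a monotone limit along compact subintervals. *)
Lemma ge0_integration_by_substitution_oo F f G a b : a < b ->
  {within `[a, b], continuous F} ->
  {in `]a, b[, forall x, is_derive x 1 F (f x)} ->
  {in `]a, b[, continuous f} ->
  {in `]a, b[, forall x, 0 < f x} ->
  {in `]F a, F b[, continuous G} ->
  {in `]F a, F b[, forall x, 0 <= G x} ->
  (\int[mu]_(x in `]F a, F b[) (G x)%:E =
   \int[mu]_(x in `]a, b[) (G (F x) * f x)%:E)%E.
Proof.
move=> ab cF dF cf f0 cG G0.
have iF := gt0_derive_homo cF dF f0.
have [aab bab] : a \in `[a, b] /\ b \in `[a, b] by rewrite !bound_itvE (ltW ab).
have ooF x : x \in `]a, b[ -> F x \in `]F a, F b[.
  move=> xab; have xab' : x \in `[a, b] by exact: subset_itv_oo_cc.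
  by rewrite in_itv/= !iF// (itvP xab).
have insetP n x : inset a b n x -> x \in `]a, b[.
  by move=> nx; suff : `]a, b[%classic x by []; rewrite -(bigcup_inset ab); exists n.
have ae n : a + gap a b n \in `]a, b[.
  by apply: (insetP n); rewrite /inset/= bound_itvE ltW// gap_lt.
have be n : b - gap a b n \in `]a, b[.
  by apply: (insetP n); rewrite /inset/= bound_itvE ltW// gap_lt.
have sub_inset n : inset a b n `<=` `]a, b[%classic by move=> x; exact: insetP.
have cFoo : {in `]a, b[, continuous F}.
  by move/(continuous_within_itvP _ ab) : cF => [].
have leF n : F (a + gap a b n) < F (b - gap a b n).
  by apply: iF; rewrite ?gap_lt//; exact: subset_itv_oo_cc.
pose Finset n := `[F (a + gap a b n), F (b - gap a b n)]%classic.
have sub_Finset n : Finset n `<=` `]F a, F b[%classic.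
  apply: subset_itv; rewrite bnd_simp.
    by have := ooF _ (ae n); rewrite in_itv/= => /andP[].
  by have := ooF _ (be n); rewrite in_itv/= => /andP[].
(* A preimage of [y] comes from the intermediate value theorem. It is interior because [y] differs
   from [F a] and [F b], hence it lies in some [inset], which [F] maps into the corresponding
   [Finset]. *)
have bigF : \bigcup_n Finset n = `]F a, F b[%classic.
  apply/seteqP; split=> [y [n _]|y yab]; first exact: sub_Finset.
  have /(IVT (ltW ab) cF)[x xab xy] : Num.min (F a) (F b) <= y <= Num.max (F a) (F b).
    have Fab := iF _ _ aab bab ab.
    rewrite (min_idPl (ltW Fab)) (max_idPr (ltW Fab)).
    by move: yab; rewrite /= in_itv/= => /andP[/ltW -> /ltW ->].
  have : `]a, b[%classic x.
    rewrite /= in_itv/= !lt_neqAle !(itvP xab) !andbT; apply/andP; split.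
      apply/eqP => ax; move: yab; rewrite /= in_itv/= -xy ax.
      by rewrite ltxx.
    apply/eqP => xb; move: yab; rewrite /= in_itv/= -xy xb.
    by rewrite ltxx andbF.
  rewrite -bigcup_inset// => -[n _ nx]; exists n => //.
  have xoo := insetP _ _ nx.
  move: nx; rewrite /inset/Finset/= !in_itv/= -xy => /andP[ax xb].
  have iF' := ltW_homo_in iF.
  by rewrite !iF'//; exact: subset_itv_oo_cc.
have cGF : {in `]a, b[, continuous (fun x => G (F x) * f x)}.
  move=> x xab; apply: cvgM; last exact: cf.
  by apply: continuous_comp; [exact: cFoo|exact/cG/ooF].
(* On a compact subinterval everything is continuous up to the ends, so the ordinary change of
   variables applies. Continuity of [derive1 F] is inherited from [f], with which it agrees near
   each interior point. *)
have step n : (\int[mu]_(x in Finset n) (G x)%:E =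
    \int[mu]_(x in inset a b n) (G (F x) * f x)%:E)%E.
  have F1 x : x \in `]a, b[ -> derive1 F x = f x.
    by move=> xab; rewrite derive1E (@derive_val _ _ _ _ _ _ _ (dF x xab)).
  have F1c x : x \in `]a, b[ -> derive1 F y @[y --> x] --> derive1 F x.
    move=> xab; rewrite F1//; apply: cvg_trans (cf x xab).
    apply: near_eq_cvg; apply: filterS (near_in_itvoo xab) => y yab.
    by rewrite F1.
  rewrite /Finset integration_by_substitution_increasing//.
  - by apply: eq_integral => x /set_mem nx; rewrite !fctE/= F1//; exact: (insetP n).
  - exact/ltW/gap_lt.
  - move=> x y nx ny; apply: iF; apply: subset_itv_oo_cc.
      exact: (insetP n).
    exact: (insetP n).
  - move=> x nx; apply: F1c; apply: (insetP n).
    exact: subset_itv_oo_cc.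
  - by apply: (cvgP (derive1 F (a + gap a b n))); exact/cvg_at_right_filter/F1c.
  - by apply: (cvgP (derive1 F (b - gap a b n))); exact/cvg_at_left_filter/F1c.
  - split.
    + move=> x nx; have xab : x \in `]a, b[.
        by apply: (insetP n); exact: subset_itv_oo_cc.
      by have [] := dF x xab.
    + exact/cvg_at_right_filter/cFoo.
    + exact/cvg_at_left_filter/cFoo.
  - apply: continuous_in_subspaceT => x /set_mem nx.
    by apply: cG; exact: (sub_Finset n).
have mG : measurable_fun `]F a, F b[%classic G.
  apply: open_continuous_measurable_fun => //.
  by move=> x /set_mem; exact: cG.
have mGF : measurable_fun `]a, b[%classic (fun x => G (F x) * f x).
  apply: open_continuous_measurable_fun => //.
  by move=> x /set_mem; exact: cGF.
have ndI : nondecreasing_seq (inset a b).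
  move=> m n mn; rewrite subsetEset; have gmn := gap_le ab mn.
  by apply: subset_itv; rewrite bnd_simp; lra.
have ndF : nondecreasing_seq Finset.
  move=> m n mn; rewrite subsetEset; have gmn := gap_le ab mn.
  have iF' := ltW_homo_in iF.
  by apply: subset_itv; rewrite bnd_simp; apply: iF'; (exact: subset_itv_oo_cc || lra).
have limF : (\int[mu]_(x in Finset n) (G x)%:E @[n --> \oo] -->
    \int[mu]_(x in \bigcup_n Finset n) (G x)%:E)%E.
  apply: ge0_nondecreasing_set_cvg_integral => //.
  - by move=> n; exact: measurable_itv.
  - by move=> n; apply/measurable_EFinP; apply: measurable_funS mG => //; exact: sub_Finset.
  - by move=> n x nx; rewrite lee_fin; exact/G0/(sub_Finset n).
have limGF : (\int[mu]_(x in inset a b n) (G (F x) * f x)%:E @[n --> \oo] -->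
    \int[mu]_(x in \bigcup_n inset a b n) (G (F x) * f x)%:E)%E.
  apply: ge0_nondecreasing_set_cvg_integral => //.
  - by move=> n; exact: measurable_itv.
  - by move=> n; apply/measurable_EFinP; apply: measurable_funS mGF => //; exact: sub_inset.
  - move=> n x /insetP xab; rewrite lee_fin mulr_ge0//; first exact/G0/ooF.
    exact/ltW/f0.
rewrite -bigF -(bigcup_inset ab).
move/cvg_lim : limF => <- //; move/cvg_lim : limGF => <- //.
by congr (limn _); apply/funext => n; exact: step.
Qed.

(** Substitution with the constant integrand 1 identifies the integral of [f] with the length of the
    interval from [F a] to [F b], which is finite. No bound on [f] near the endpoints enters. *)
Lemma gt0_derive_integrable F f a b : a < b ->
  {within `[a, b], continuous F} ->
  {in `]a, b[, forall x, is_derive x 1 F (f x)} ->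
  {in `]a, b[, continuous f} ->
  {in `]a, b[, forall x, 0 < f x} ->
  mu.-integrable `[a, b] (EFin \o f).
Proof.
move=> ab cF dF cf f0.
have mf := continuous_oo_measurable_fun cf.
apply/integrableP; split; first exact/measurable_EFinP.
rewrite integral_itv_bndoo; last first.
  apply/measurableT_comp/measurable_EFinP => //.
  exact/measurable_fun_itv_obnd_cbndP/measurable_fun_itv_bndo_bndcP.
have subst : (\int[mu]_(x in `]F a, F b[) (cst 1 x)%:E =
    \int[mu]_(x in `]a, b[) (cst 1 (F x) * f x)%:E)%E.
  by apply: ge0_integration_by_substitution_oo => // ? _; exact: cvg_cst.
rewrite (_ : (\int[mu]_(x in _) _ = \int[mu]_(x in `]a, b[) (cst 1 (F x) * f x)%:E)%E).
  rewrite -subst -[X in (X < _)%E]/(\int[mu]_(x in `]F a, F b[) (cst 1%:E x))%E.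
  rewrite integral_cst// mul1e /= lebesgue_measure_itv/=.
  by case: ifP => // _; rewrite -EFinB ltry.
by apply: eq_integral => x /set_mem xab; rewrite /= mul1r gtr0_norm//; exact: f0.
Qed.

(* The derivative need not be bounded near the endpoints: F and the integral
   of f are continuous on [a, b] and their difference has zero derivative. *)
Lemma integrable_FTC2 F f a b : a < b ->
  mu.-integrable `[a, b] (EFin \o f) ->
  {within `[a, b], continuous F} ->
  {in `]a, b[, forall x, is_derive x 1 F (f x)} ->
  {in `]a, b[, continuous f} ->
  \int[mu]_(x in `[a, b]) f x = F b - F a.
Proof.
move=> ab If cF dF cf.
pose P x := \int[mu]_(t in `[a, x]) f t.
have cP : {within `[a, b], continuous P}.
  exact: (parameterized_integral_continuous (ltW ab) If).
have dP x : x \in `]a, b[ -> is_derive x 1 P (f x).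
  move=> xab; have [ax xb] : a < x /\ x < b by rewrite !(itvP xab).
  have [dx vx] := continuous_FTC1_closed xb If ax (cf x xab).
  by apply: (DeriveDef dx); rewrite -derive1E -[RHS]vx.
have dPF x : x \in `]a, b[ -> is_derive x 1 (P - F) ((fun=> 0) x).
  by move=> xab; have := is_deriveB (dP x xab) (dF x xab); rewrite subrr.
have cPF : {within `[a, b], continuous (P - F)}.
  by move=> x; apply: cvgB; [exact: cP|exact: cF].
have [c _] := MVT ab dPF cPF.
rewrite mul0r !fctE {2}/P set_itv1 Rintegral_set1 => /eqP.
by rewrite subr_eq0 sub0r subr_eq addrC => /eqP.
Qed.

End calculus.

(** * Derivatives and continuity of real powers *)

Section real_powers.
Context {R : realType}.
Implicit Types (a x : R) (g : R -> R).

Lemma gt0_powRB x a (b : R) : 0 < x -> x `^ (a - b) = x `^ a / x `^ b.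
Proof. by move=> x0; rewrite powRB// (gt_eqF x0) implybT. Qed.

Lemma gt0_powR1B x a : 0 < x -> x `^ (1 - a) = x / x `^ a.
Proof. by move=> x0; rewrite gt0_powRB// powRr1// ltW. Qed.

Lemma is_derive_powR_comp g a x (dg : R) : 0 < g x -> is_derive x 1 g dg ->
  is_derive x 1 (fun y => g y `^ a) (a * g x `^ (a - 1) * dg).
Proof.
move=> gx0 dgx; have gx : g x \in `]0, +oo[ by rewrite in_itv/= gx0.
have dp : is_derive (g x) 1 (@powR R ^~ a) (a * g x `^ (a - 1)).
  by apply: DeriveDef; [exact: derivable_powR|rewrite -derive1E powR_derive1].
exact: (is_derive1_comp dp dgx).
Qed.

Lemma is_derive_powR a x : 0 < x ->
  is_derive x 1 (@powR R ^~ a) (a * x `^ (a - 1)).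
Proof. by move=> x0; rewrite -[X in is_derive _ _ _ X]mulr1; exact: is_derive_powR_comp. Qed.

Lemma continuous_powR a x : 0 < x -> {for x, continuous (@powR R ^~ a)}.
Proof.
move=> x0; apply/differentiable_continuous/derivable1_diffP.
by apply: derivable_powR; rewrite in_itv/= x0.
Qed.

Lemma continuous_powR_comp g a x : 0 < g x -> {for x, continuous g} ->
  {for x, continuous (fun y => g y `^ a)}.
Proof.
move=> gx0 cg; apply: (@continuous_comp _ _ _ g (@powR R ^~ a)) => //.
exact: continuous_powR.
Qed.

(* [powR] is 1 on negative numbers, hence discontinuous at 0. *)
Lemma continuous_norm_powR a : 0 < a -> continuous (fun x : R => `|x| `^ a).
Proof.
move=> a0 x; have [->|x0] := eqVneq x 0; last first.
  apply: (@continuous_powR_comp (fun y => `|y|)); first by rewrite normr_gt0.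
  exact: norm_continuous.
rewrite /continuous_at normr0 powR0 ?gt_eqF//; apply/cvgrPdist_lt => e e0.
near=> y; rewrite sub0r normrN ger0_norm ?powR_ge0//.
(* Writing $e$ as $(e^{1/a})^a$ reduces the bound to $|y| < e^{1/a}$, which gives the radius of the
   neighbourhood. *)
rewrite -[ltRHS]powRr1 ?ltW// -(mulVf (lt0r_neq0 a0)) powRrM.
apply: (gt0_ltr_powR a0); rewrite ?nnegrE ?powR_ge0//.
near: y; exists (e `^ a^-1) => /=; first exact: powR_gt0.
by move=> y /=; rewrite sub0r normrN.
Unshelve. all: by end_near. Qed.

End real_powers.

(** * Moments of the weight *)

Section moments.
Context {R : realType}.
Notation mu := (@lebesgue_measure R).
Implicit Types (y : R) (m : nat).
Variables (p v r k : R).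
Hypotheses (hp : 1 < p) (hv : 1 <= v) (hr : 1 < r) (hk0 : 0 < k) (hk1 : k < 1).

(** A natural power of $x = y^v$, rather than $y^{vm}$, makes relations between consecutive moments
    polynomial in $x$. *)
Definition momentK (m : nat) (y : R) : R := (y `^ v) ^+ m * integrandK p v r k y.

Local Notation kv := (k `^ v).

Let v_gt0 : 0 < v. Proof. exact: lt_le_trans hv. Qed.

Let powR1v : 1 `^ v = 1 :> R. Proof. by rewrite powR1. Qed.

Let kv_bound : 0 < kv < 1.
Proof.
rewrite powR_gt0//= -[X in _ < X]powR1v.
by apply: (gt0_ltr_powR v_gt0) => //; rewrite nnegrE ?ler01// ltW.
Qed.

Let powRv_le1 y : y \in `[0, 1] -> 0 <= y `^ v <= 1.
Proof.
rewrite in_itv/= => /andP[y0 y1]; rewrite powR_ge0/= -[X in _ <= X]powR1v.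
by apply: (ge0_ler_powR (ltW v_gt0)) => //; rewrite ?nnegrE ?ler01// ltW.
Qed.

Let powRv_lt1 y : y \in `]0, 1[ -> 0 < y `^ v < 1.
Proof.
rewrite in_itv/= => /andP[y0 y1]; rewrite powR_gt0//= -[X in _ < X]powR1v.
by apply: (gt0_ltr_powR v_gt0) => //; rewrite nnegrE ?ler01// ltW.
Qed.

(** Since $k < 1$, this factor stays positive up to $y = 1$; the only singularity of the weight
    comes from the factor $1 - y^v$. *)
Let kvpow_gt0 y : y \in `[0, 1] -> 0 < 1 - kv * y `^ v.
Proof. by move=> /powRv_le1 ?; have := kv_bound; nra. Qed.

Let in01_cc y : y \in `]0, 1[ -> y \in `[0, 1].
Proof. exact: subset_itv_oo_cc. Qed.

Lemma integrandK_gt0 y : y \in `]0, 1[ -> 0 < integrandK p v r k y.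
Proof.
move=> y01; rewrite /integrandK divr_gt0// mulr_gt0// powR_gt0//.
  by have /andP[_ ?] := powRv_lt1 y01; rewrite subr_gt0.
exact/kvpow_gt0/in01_cc.
Qed.

Lemma continuous_integrandK y : y \in `]0, 1[ ->
  {for y, continuous (integrandK p v r k)}.
Proof.
move=> y01; have cv : {for y, continuous (@powR R ^~ v)}.
  by apply: continuous_powR; rewrite (itvP y01).
have /andP[_ yv1] := powRv_lt1 y01.
rewrite /integrandK; apply: cvgM; first exact: cvg_cst.
apply: cvgV.
  rewrite gt_eqF// mulr_gt0// powR_gt0//; first by rewrite subr_gt0.
  exact/kvpow_gt0/in01_cc.
apply: cvgM.
  apply: (@continuous_powR_comp _ (fun y => 1 - y `^ v)); first by rewrite subr_gt0.
  by apply: cvgB => //; exact: cvg_cst.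
apply: (@continuous_powR_comp _ (fun y => 1 - k `^ v * y `^ v)).
  exact/kvpow_gt0/in01_cc.
by apply: cvgB; [exact: cvg_cst|apply: cvgM => //; exact: cvg_cst].
Qed.

Lemma continuous_momentK m y : y \in `]0, 1[ ->
  {for y, continuous (momentK m)}.
Proof.
move=> y01; apply: cvgM; last exact: continuous_integrandK.
apply: (@continuous_comp _ _ _ (@powR R ^~ v) (fun x => x ^+ m)); last exact: exprn_continuous.
by apply: continuous_powR; rewrite (itvP y01).
Qed.

Let integrable_scale (c : R) (f : R -> R) : mu.-integrable `[0, 1] (EFin \o f) ->
  mu.-integrable `[0, 1] (EFin \o (fun y => c * f y)).
Proof.
move=> If; suff : mu.-integrable `[0, 1] (fun y => c%:E * (EFin \o f) y)%E by [].
exact: integrableZl.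
Qed.

Let integrable_onem_powRN :
  mu.-integrable `[0, 1] (EFin \o (fun y : R => 1 / (1 - y) `^ (1 / p))).
Proof.
have p1 : 0 < 1 - 1 / p by rewrite subr_gt0 ltr_pdivrMr ?mul1r// (lt_trans _ hp).
(* An antiderivative on the open interval, continuous up to 1 because $1 - 1/p > 0$. The absolute
   value makes it continuous on the whole line and changes nothing for $y < 1$. *)
pose F (y : R) := - (1 - 1 / p)^-1 * `|1 - y| `^ (1 - 1 / p).
apply: (@gt0_derive_integrable _ F) => //.
- apply: continuous_subspaceT => y; apply: cvgM; first exact: cvg_cst.
  apply: (@continuous_comp _ _ _ (fun y => 1 - y) (fun x => `|x| `^ (1 - 1 / p))).
    by apply: cvgB; [exact: cvg_cst|exact: cvg_id].
  exact: continuous_norm_powR.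
- move=> y; rewrite in_itv/= => /andP[y0 y1].
  have y1' : 0 < 1 - y by rewrite subr_gt0.
  have d1 : is_derive y 1 (fun z : R => 1 - z) (0 - 1) by apply: is_deriveB.
  have d2 := is_deriveM (is_derive_cst (- (1 - 1 / p)^-1) y 1)
    (@is_derive_powR_comp _ (fun z => 1 - z) (1 - 1 / p) y _ y1' d1).
  have {}d2 := is_derive_eq d2 (_ : _ = 1 / (1 - y) `^ (1 / p)).
  apply: near_eq_is_derive (d2 _); last first.
    have sE (c d : R) : c *: d = c * d by [].
    rewrite !sE /= (_ : 1 - 1 / p - 1 = - (1 / p)); last by ring.
    by rewrite powRN; field; rewrite (lt0r_neq0 (powR_gt0 _ y1')) !lt0r_neq0 ?subr_gt0// (lt_trans _ hp).
  have : \forall z \near y, z < 1 by exact: lt_nbhsl.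
  apply: filterS => z z1.
  by rewrite /F /= !fctE ger0_norm// subr_ge0 ltW.
- move=> y; rewrite in_itv/= => /andP[y0 y1].
  have y1' : 0 < 1 - y by rewrite subr_gt0.
  apply: cvgM; first exact: cvg_cst.
  apply: cvgV; first by rewrite gt_eqF// powR_gt0.
  apply: (@continuous_powR_comp _ (fun y => 1 - y)) => //.
  by apply: cvgB; [exact: cvg_cst|exact: cvg_id].
- move=> y; rewrite in_itv/= => /andP[y0 y1].
  by rewrite divr_gt0// powR_gt0// subr_gt0.
Qed.

(** Domination by a multiple of $(1-y)^{-1/p}$: as $v \ge 1$, $y^v \le y$ gives $1 - y \le 1 - y^v$;
    the second factor of the weight is at least its value at $y = 1$, and the power of $y^v$ is at
    most 1. *)
Lemma integrable_momentK m : mu.-integrable `[0, 1] (EFin \o momentK m).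
Proof.
have kvlt1 : 0 < 1 - kv by have := kv_bound; lra.
pose C := ((1 - kv) `^ (1 - 1 / r))^-1.
have C0 : 0 < C by rewrite invr_gt0 powR_gt0.
have IC : mu.-integrable `[0, 1] (EFin \o (fun y => C * (1 / (1 - y) `^ (1 / p)))).
  by apply: integrable_scale; exact: integrable_onem_powRN.
apply: (le_integrable _ _ _ IC); first exact: measurable_itv.
  apply/measurable_EFinP; apply: continuous_oo_measurable_fun => y.
  exact: continuous_momentK.
move=> y y01; rewrite /= lee_fin /momentK /integrandK.
have /andP[yv0 yv1] := powRv_le1 y01.
rewrite ger0_norm; last first.
  by rewrite mulr_ge0// ?exprn_ge0// div1r invr_ge0 mulr_ge0// powR_ge0.
rewrite ger0_norm; last first.
  by rewrite mulr_ge0// ?(ltW C0)// div1r invr_ge0 powR_ge0.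
move: (y01); rewrite /= in_itv/= => /andP[y0].
(* At $y = 1$ both sides are 0, by the convention that the inverse of 0 is 0. *)
rewrite le_eqVlt => /predU1P[->|y1].
  have e : 1 / p != 0 by rewrite div1r invr_eq0 gt_eqF// (lt_trans _ hp).
  by rewrite powR1 subrr powR0// mul0r invr0 !mulr0.
have y1' : 0 < 1 - y by rewrite subr_gt0.
have le1 : 1 - y <= 1 - y `^ v.
  rewrite lerD2l lerN2; move: y0; rewrite le_eqVlt => /predU1P[<-|y0].
    by rewrite powR0// gt_eqF.
  by apply: ge1r_powR => //; rewrite y0 ltW.
have yv1' : 0 < 1 - y `^ v by exact: lt_le_trans le1.
apply: (@le_trans _ _ (1 * (1 / ((1 - y `^ v) `^ (1 / p) * (1 - kv * y `^ v) `^ (1 - 1 / r))))).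
  by rewrite ler_wpM2r ?exprn_ile1// div1r invr_ge0 mulr_ge0// powR_ge0.
rewrite mul1r.
set P := (1 - y `^ v) `^ (1 / p); set Q := (1 - kv * y `^ v) `^ (1 - 1 / r).
rewrite (_ : 1 / (P * Q) = Q^-1 * P^-1); last by rewrite div1r invfM mulrC.
rewrite [1 / _]div1r /P /Q; apply: ler_pM; [by rewrite invr_ge0 powR_ge0..| |].
  rewrite lef_pV2 ?posrE ?powR_gt0//; last exact: kvpow_gt0.
  have r1 : 0 <= 1 - 1 / r.
    by rewrite subr_ge0 ler_pdivrMr ?mul1r ?(ltW hr)// (lt_trans _ hr).
  apply: (ge0_ler_powR r1); rewrite ?nnegrE ?(ltW kvlt1)//.
  - exact/ltW/kvpow_gt0.
  - by have /andP[? _] := kv_bound; nra.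
rewrite lef_pV2 ?posrE ?powR_gt0//.
have p1 : 0 <= 1 / p by rewrite div1r invr_ge0 (le_trans _ (ltW hp)).
by apply: (ge0_ler_powR p1); rewrite ?nnegrE ?(ltW y1')// (ltW yv1').
Qed.

Definition integralK m : R := \int[mu]_(y in `[0, 1]) momentK m y.

Lemma ellK_moment : ellK p v r k = integralK 0.
Proof. by apply: eq_Rintegral => y _; rewrite /momentK expr0 mul1r. Qed.

(** Since $1/r = 1 - (1 - 1/r)$, the integrand of $E$ is $1 - k^v y^v$ times that of $K$. *)
Lemma ellE_moment : ellE p v r k = integralK 0 - kv * integralK 1.
Proof.
rewrite -RintegralZl ?integrable_momentK// -RintegralB ?integrable_momentK//; last first.
  by apply: integrable_scale; exact: integrable_momentK.
apply: eq_Rintegral => y /set_mem y01.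
rewrite /momentK /integrandE /integrandK expr0 expr1 !div1r invfM.
have ky := kvpow_gt0 y01.
have -> : (1 - kv * y `^ v) `^ r^-1 = (1 - kv * y `^ v) / (1 - kv * y `^ v) `^ (1 - r^-1).
  rewrite -gt0_powR1B//.
  by congr (_ `^ _); ring.
by ring.
Qed.

Let boundary (m : nat) (y : R) : R :=
  y `^ (v * m%:R + 1) * ((1 - y `^ v) `^ (1 - 1 / p) * (1 - kv * y `^ v) `^ (1 / r)).

(** With $x = y^v$, the derivative of [boundary] over the common denominator
    $(1-x)^{1/p}(1-k^vx)^{1-1/r}$ has numerator $x^m$ times a quadratic in $x$; these are its
    coefficients, the middle one with opposite sign. *)
Let coef0 m : R := 1 + v * m%:R.
Let coef1 m : R := (1 + v * m%:R) * (1 + kv) + (1 - 1 / p) * v + 1 / r * kv * v.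
Let coef2 m : R := kv * (1 + v * m%:R + (1 - 1 / p) * v + 1 / r * v).

Let dboundary (m : nat) (y : R) : R :=
  coef0 m * momentK m y - coef1 m * momentK m.+1 y + coef2 m * momentK m.+2 y.

Let is_derive_boundary m y : y \in `]0, 1[ ->
  is_derive y 1 (boundary m) (dboundary m y).
Proof.
move=> y01; have [y0 y1] : 0 < y /\ y < 1 by rewrite !(itvP y01).
have /andP[yv0 yv1] := powRv_lt1 y01.
have yv1' : 0 < 1 - y `^ v by rewrite subr_gt0.
have ky := kvpow_gt0 (in01_cc y01).
have d1 := is_derive_powR (v * m%:R + 1) y0.
have dv := is_derive_powR v y0.
have cst_derive (c : R) : is_derive y 1 (cst c : R -> R) 0 by exact: is_derive_cst.
have d2 := @is_derive_powR_comp _ (fun z => 1 - z `^ v) (1 - 1 / p) y _ yv1'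
  (is_deriveB (cst_derive 1) dv).
have d3 := @is_derive_powR_comp _ (fun z => 1 - kv * z `^ v) (1 / r) y _ ky
  (is_deriveB (cst_derive 1) (is_deriveM (cst_derive kv) dv)).
apply: is_derive_eq (is_deriveM d1 (is_deriveM d2 d3)) _.
rewrite /dboundary /momentK /integrandK !fctE /=.
have sE (a b : R) : a *: b = a * b by [].
rewrite !sE.
(* All powers are now expressed through $y$, $x = y^v$, $x^m$ and the two factors of the
   denominator, which leaves a rational identity. *)
have -> : v * m%:R + 1 - 1 = v * m%:R by ring.
rewrite (@powRD _ y (v * m%:R) 1); last by rewrite (gt_eqF y0) implybT.
rewrite powRr1 ?(ltW y0)// powRrM powR_mulrn ?powR_ge0//.
rewrite (gt0_powRB v 1 y0) powRr1 ?(ltW y0)//.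
have -> : 1 - 1 / p - 1 = - (1 / p) by ring.
rewrite powRN (gt0_powR1B (1 / p) yv1').
have -> : 1 / r - 1 = - (1 - 1 / r) by ring.
rewrite powRN.
have -> : (1 - kv * y `^ v) `^ (1 / r) = (1 - kv * y `^ v) / (1 - kv * y `^ v) `^ (1 - 1 / r).
  rewrite -gt0_powR1B//.
  by congr (_ `^ _); ring.
have P0 : (1 - y `^ v) `^ (1 / p) != 0 by rewrite gt_eqF// powR_gt0.
have Q0 : (1 - kv * y `^ v) `^ (1 - 1 / r) != 0 by rewrite gt_eqF// powR_gt0.
rewrite /coef0 /coef1 /coef2 !exprS.
move: P0 Q0; set P := _ `^ (1 / p); set Q := _ `^ (1 - 1 / r); set x := y `^ v; set X := x ^+ m.
move=> P0 Q0; field.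
by rewrite P0 Q0 (gt_eqF y0) !gt_eqF// (lt_trans _ hp, lt_trans _ hr).
Qed.

Let continuous_boundary m : {within `[0, 1], continuous (boundary m)}.
Proof.
have p1 : 0 < 1 - 1 / p by rewrite subr_gt0 ltr_pdivrMr ?mul1r// (lt_trans _ hp).
have r1 : 0 < 1 / r by rewrite divr_gt0// (lt_trans _ hr).
have vm : 0 < v * m%:R + 1 by rewrite ltr_wpDl// mulr_ge0// ltW.
(* All exponents are positive, so inserting absolute values gives a function continuous on the whole
   line that agrees with [boundary] on the segment. *)
pose g (y : R) := `|y| `^ (v * m%:R + 1) *
  (`|1 - `|y| `^ v| `^ (1 - 1 / p) * `|1 - kv * `|y| `^ v| `^ (1 / r)).
have cv := continuous_norm_powR v_gt0.
apply: (@subspace_eq_continuous _ _ _ g).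
  move=> y /set_mem y01; have := kvpow_gt0 y01; have /andP[? ?] := powRv_le1 y01.
  move: y01; rewrite /= in_itv/= => /andP[y0 _] ?.
  by rewrite /g (ger0_norm y0) ger0_norm ?subr_ge0// ger0_norm// ltW.
apply: continuous_subspaceT => y; apply: cvgM; first exact: continuous_norm_powR.
apply: cvgM.
  apply: (@continuous_comp _ _ _ (fun y => 1 - `|y| `^ v) (fun x => `|x| `^ (1 - 1 / p))).
    by apply: cvgB; [exact: cvg_cst|exact: cv].
  exact: continuous_norm_powR.
apply: (@continuous_comp _ _ _ (fun y => 1 - kv * `|y| `^ v) (fun x => `|x| `^ (1 / r))).
  by apply: cvgB; [exact: cvg_cst|apply: cvgM; [exact: cvg_cst|exact: cv]].
exact: continuous_norm_powR.
Qed.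

Lemma integralK_rec m :
  kv * (m%:R + 1 / v + (1 - 1 / p) + 1 / r) * integralK m.+2 =
  (m%:R + 1 / v + (1 - 1 / p) + (m%:R + 1 / v + 1 / r) * kv) * integralK m.+1
  - (1 / v + m%:R) * integralK m.
Proof.
have If := integrable_momentK.
have IZ (c : R) j : mu.-integrable `[0, 1] (EFin \o (fun y => c * momentK j y)).
  by apply: integrable_scale; exact: If.
have IB : mu.-integrable `[0, 1]
    (EFin \o (fun y => coef0 m * momentK m y - coef1 m * momentK m.+1 y)).
  suff : mu.-integrable `[0, 1] (fun y =>
      (coef0 m * momentK m y)%:E - (coef1 m * momentK m.+1 y)%:E)%E by [].
  by apply: integrableB => //; exact: IZ.
have ID : mu.-integrable `[0, 1] (EFin \o dboundary m).
  suff : mu.-integrable `[0, 1] ((fun y =>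
      (coef0 m * momentK m y - coef1 m * momentK m.+1 y)%:E) \+
      (fun y => (coef2 m * momentK m.+2 y)%:E))%E by [].
  by apply: integrableD => //; exact: IZ.
have cd : {in `]0, 1[, continuous (dboundary m)}.
  move=> y y01; apply: cvgD; first apply: cvgB.
  - by apply: cvgM; [exact: cvg_cst|exact: continuous_momentK].
  - by apply: cvgM; [exact: cvg_cst|exact: continuous_momentK].
  - by apply: cvgM; [exact: cvg_cst|exact: continuous_momentK].
have cb : {within `[0, 1], continuous (boundary m)} by exact: continuous_boundary.
have := integrable_FTC2 ltr01 ID cb (@is_derive_boundary m) cd.
have p1 : 1 - 1 / p != 0 by rewrite subr_eq0 eq_sym lt_eqF// ltr_pdivrMr ?mul1r// (lt_trans _ hp).
have vm : v * m%:R + 1 != 0 by rewrite gt_eqF// ltr_wpDl// mulr_ge0// ltW.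
(* Both boundary terms vanish: the first factor at 0, the power of $1 - y^v$ at 1. The exponents
   must be nonzero, since a zero exponent would give the value 1. *)
rewrite /boundary [0 `^ (_ + _)]powR0// !powR1 subrr (powR0 p1) !mul0r mulr0 subrr.
rewrite RintegralD// RintegralB// !RintegralZl// -!/(integralK _) /coef0 /coef1 /coef2.
move: (integralK m) (integralK m.+1) (integralK m.+2) => J0 J1 J2 rec.
(* The integrated identity is $v$ times the claimed recurrence. *)
have v0 := lt0r_neq0 v_gt0; apply: (mulfI v0).
have p0 : p != 0 by rewrite gt_eqF// (lt_trans _ hp).
have r0 : r != 0 by rewrite gt_eqF// (lt_trans _ hr).
have -> : v * (kv * (m%:R + 1 / v + (1 - 1 / p) + 1 / r) * J2) =
    kv * (1 + v * m%:R + (1 - 1 / p) * v + 1 / r * v) * J2.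
  by field; rewrite v0 r0 p0.
by rewrite -[LHS]subr0 -[X in _ - X]rec; field; rewrite v0 r0 p0.
Qed.

End moments.

(** * From a three-term recurrence to products of matrices *)

Section matrix_recurrence.
Context {R : realType}.

(** Each [matA] advances the column $(J_{m+1}, J_m)$ by one index, up to the leading coefficient of
    the recurrence; these coefficients accumulate into the power of $k^q$ and the Pochhammer factor.
    The boolean [i == 0] selects the later moment for the top row. *)
Lemma matW_recurrence (p q r u k : R) (J : nat -> R) :
  (forall m : nat,
     k `^ q * (1 / conj_exponent p + 1 / u + 1 / r + m%:R) * J m.+2 =
     (m%:R + 1 / u + 1 / conj_exponent p + (m%:R + 1 / u + 1 / r) * k `^ q) * J m.+1
     - (1 / u + m%:R) * J m) ->
  forall (n : nat) (i : 'I_2),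
    matW p q r u k n i 0 * J 1%N + matW p q r u k n i 1 * J 0%N =
    (k `^ q) ^+ n * pochhammer (1 / conj_exponent p + 1 / u + 1 / r) n * J (n + (i == 0%R))%N.
Proof.
have lift01 : lift ord0 ord0 = 1 :> 'I_2 by apply/val_inj.
have ord2P (i : 'I_2) : i = 0 \/ i = 1.
  by case: i => [[|[|//]] ?]; [left|right]; exact/val_inj.
move=> rec; elim=> [|n IH] i.
  rewrite /pochhammer big_ord0 expr0 !mul1r add0n !mxE.
  by case: (ord2P i) => ->; rewrite /= ?mul0r ?mul1r ?addr0 ?add0r.
rewrite /pochhammer big_ord_recr /= -/(pochhammer _ n) exprS !mxE.
rewrite !big_ord_recl !big_ord0 !addr0 !lift01.
have := IH ord0; have := IH 1; rewrite /= addn0 addn1 => IH1 IH0.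
have := rec n; move: (pochhammer _ _) IH0 IH1 => P IH0 IH1 recn.
case: (ord2P i) => ->; rewrite !mxE /= ?addn1 ?addn0.
  (* The top row combines both induction hypotheses and then applies the recurrence at [n]. The
     bottom row, treated afterwards, merely rescales $J_{n+1}$. *)
  transitivity ((n%:R + 1 / u + 1 / conj_exponent p + (n%:R + 1 / u + 1 / r) * k `^ q)
      * ((k `^ q) ^+ n * P * J n.+1) + (- (1 / u) - n%:R) * ((k `^ q) ^+ n * P * J n)).
    by rewrite -IH0 -IH1; ring.
  transitivity ((k `^ q) ^+ n * P *
    ((n%:R + 1 / u + 1 / conj_exponent p + (n%:R + 1 / u + 1 / r) * k `^ q) * J n.+1
     - (1 / u + n%:R) * J n)); first by ring.
  by rewrite -recn; ring.
rewrite !mul0r !addr0; transitivity ((n%:R + 1 / u + 1 / conj_exponent p + 1 / r) * k `^ q *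
   ((k `^ q) ^+ n * P * J n.+1)); first by rewrite -IH0; ring.
by ring.
Qed.

End matrix_recurrence.

(** * The function sn and the integrals of its powers *)

Section sn_integral.
Context {R : realType}.
Notation mu := (@lebesgue_measure R).
Variables (p q r k : R).
Hypotheses (hp : 1 < p) (hq : 1 < q) (hr : 1 < r) (hk0 : 0 < k) (hk1 : k < 1).
Implicit Types x y t : R.

Local Notation f := (integrandK p q r k).
Local Notation H := (fun x => ellH p q r x k).
Local Notation sn := (fun t => ellsn p q r t k).

Let integrable_f : mu.-integrable `[0, 1] (EFin \o f).
Proof.
apply: eq_integrable (integrable_momentK hp (ltW hq) hr hk0 hk1 0) => //.
by move=> x _; rewrite /= /momentK expr0 mul1r.
Qed.

Let continuous_f : {in `]0, 1[, continuous f}.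
Proof. by move=> x; exact: continuous_integrandK (ltW hq) hk0 hk1 x. Qed.

Let f_gt0 : {in `]0, 1[, forall x, 0 < f x}.
Proof. by move=> x; exact: integrandK_gt0 (ltW hq) hk0 hk1 x. Qed.

Lemma continuous_ellH : {within `[0, 1], continuous H}.
Proof. exact: (parameterized_integral_continuous ler01 integrable_f). Qed.

Lemma is_derive_ellH : {in `]0, 1[, forall x, is_derive x 1 H (f x)}.
Proof.
move=> x x01; have [x0 x1] : 0 < x /\ x < 1 by rewrite !(itvP x01).
have [dx vx] := continuous_FTC1_closed x1 integrable_f x0 (continuous_f x01).
by apply: (DeriveDef dx); rewrite -derive1E -[RHS]vx.
Qed.

Lemma ellH_homo : {in `[0, 1] &, {homo H : x y / x < y}}.
Proof. exact: gt0_derive_homo continuous_ellH is_derive_ellH f_gt0. Qed.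

Lemma ellHK : {in `[0, 1], cancel H sn}.
Proof.
have injH : {in (`[0, 1]%classic : set R) &, injective H}.
  move=> x y /set_mem x01 /set_mem y01.
  exact: (inc_inj_in (le_mono_in ellH_homo)).
by move=> x x01; apply: (pinvKV (fun=> 0) injH); rewrite inE.
Qed.

Lemma ellH0 : ellH p q r 0 k = 0.
Proof. by rewrite /ellH set_itv1 Rintegral_set1. Qed.

Lemma ellH_surj t : t \in `[0, ellK p q r k] -> exists2 x, x \in `[0, 1] & H x = t.
Proof.
move=> t0K; apply: (IVT ler01 continuous_ellH); rewrite /= ellH0.
have K0 : 0 <= ellH p q r 1 k.
  by rewrite -ellH0 ltW// ellH_homo ?bound_itvE.
by rewrite (min_idPl K0) (max_idPr K0); move: t0K; rewrite in_itv.
Qed.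

(** Serves the continuity of the powers of [sn]: the exponent $qn + R$ is negative when $n = 0$ and
    $R < 0$. *)
Lemma ellsn_gt0 t : t \in `]0, ellK p q r k[ -> 0 < sn t.
Proof.
move=> t0K; have [x x01 xt] := ellH_surj (subset_itv_oo_cc t0K).
rewrite -xt ellHK// lt_neqAle (itvP x01) andbT; apply/eqP => x0.
by move: t0K; rewrite -xt -x0 ellH0 in_itv/= ltxx.
Qed.

Lemma continuous_ellsn : {in `]0, ellK p q r k[, continuous sn}.
Proof.
move=> t t0K; have := segment_can_le_continuous ler01 continuous_ellH ellHK.
rewrite /= ellH0 => csn; apply: (within_continuous_continuous _ csn t0K).
by move: t0K; rewrite in_itv/= => /andP[]; exact: lt_trans.
Qed.

(* The substitution [t = H (y `^ (1 / s))] turns the integral of a power of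
   [sn] into a moment of the weight with [q] replaced by [q / s]. *)
Lemma integral_ellsn_powR (s : R) (n : nat) : 0 < s -> s <= q ->
  (\int[mu]_(t in `[0%R, ellK p q r k]) (sn t `^ (q * n%:R + (s - 1)))%:E =
   (s^-1 * integralK p (q / s) r (k `^ s) n)%:E)%E.
Proof.
move=> s0 sq.
pose g y := y `^ (1 / s); pose F y := H (g y).
have s1 : 0 < 1 / s by rewrite divr_gt0.
have q0 : 0 < q by exact: lt_trans hq.
have g0 : g 0 = 0 by rewrite /g powR0// gt_eqF.
have g1 : g 1 = 1 by rewrite /g powR1.
have g_homo : {in `[0, 1] &, {homo g : x y / x < y}}.
  move=> x y x01 y01; apply: (gt0_ltr_powR s1); rewrite nnegrE.
    by rewrite (itvP x01).
  by rewrite (itvP y01).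
have gcc y : y \in `[0, 1] -> g y \in `[0, 1].
  move=> y01; rewrite in_itv/= powR_ge0/= -[leRHS]g1.
  by apply: (ltW_homo_in g_homo); rewrite ?bound_itvE// (itvP y01).
have goo y : y \in `]0, 1[ -> g y \in `]0, 1[.
  move=> y01; rewrite in_itv/= -{1}g0 -[X in _ && (_ < X)]g1.
  by rewrite !g_homo ?bound_itvE ?ler01 ?(itvP y01)//; exact: subset_itv_oo_cc.
have F0 : F 0 = 0 by rewrite /F g0 ellH0.
have F1 : F 1 = ellK p q r k by rewrite /F g1.
have F_homo : {in `[0, 1] &, {homo F : x y / x < y}}.
  by move=> x y x01 y01 xy; apply: ellH_homo; [exact: gcc..|exact: g_homo].
(* A strictly increasing surjection between segments is continuous; this avoids the jump of [powR]
   at 0. A preimage of $H(x)$ is $x^s$. *)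
have cF : {within `[0, 1], continuous F}.
  apply: segment_inc_surj_continuous; first exact: le_mono_in.
  rewrite F0 F1 => t /= /ellH_surj[x x01 <-].
  have [x0 x1] : 0 <= x /\ x <= 1 by rewrite !(itvP x01).
  exists (x `^ s).
    rewrite /= in_itv/= powR_ge0/= -[leRHS](_ : 1 `^ s = 1); last by rewrite powR1.
    by apply: (ge0_ler_powR (ltW s0)); rewrite ?nnegrE.
  by rewrite /F /g -powRrM mul1r mulfV ?gt_eqF// powRr1.
pose dF y := f (g y) * (1 / s * y `^ (1 / s - 1)).
have is_derive_F : {in `]0, 1[, forall y, is_derive y 1 F (dF y)}.
  move=> y y01; have y0 : 0 < y by rewrite (itvP y01).
  exact: (is_derive1_comp (is_derive_ellH (goo y y01)) (is_derive_powR (1 / s) y0)).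
have cdF : {in `]0, 1[, continuous dF}.
  move=> y y01; have y0 : 0 < y by rewrite (itvP y01).
  apply: cvgM.
    apply: (@continuous_comp _ _ _ g f); first exact: continuous_powR.
    exact/continuous_f/goo.
  by apply: cvgM; [exact: cvg_cst|exact: continuous_powR].
have dF0 : {in `]0, 1[, forall y, 0 < dF y}.
  move=> y y01; have y0 : 0 < y by rewrite (itvP y01).
  by rewrite mulr_gt0 ?f_gt0 ?goo// mulr_gt0// powR_gt0.
pose a := q * n%:R + (s - 1).
have csn : {in `]0, ellK p q r k[, continuous (fun t => sn t `^ a)}.
  move=> t t0K; apply: (@continuous_powR_comp _ sn); first exact: ellsn_gt0.
  exact: continuous_ellsn.
have hv : 1 <= q / s by rewrite ler_pdivlMr// mul1r.
have ks0 : 0 < k `^ s by rewrite powR_gt0.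
have ks1 : k `^ s < 1.
  rewrite -[ltRHS](_ : 1 `^ s = 1); last by rewrite powR1.
  by apply: (gt0_ltr_powR s0); rewrite ?nnegrE ?ltW.
have IJ := integrable_momentK hp hv hr ks0 ks1 n.
have -> : (s^-1 * integralK p (q / s) r (k `^ s) n)%:E =
    (\int[mu]_(y in `[0%R, 1%R]) (s^-1 * momentK p (q / s) r (k `^ s) n y)%:E)%E.
  rewrite EFinM /integralK /Rintegral fineK ?integrable_fin_num//.
  by rewrite -integralZl.
rewrite integral_itv_bndoo; last first.
  apply/measurable_EFinP; apply: open_continuous_measurable_fun => //.
  by move=> t /set_mem; exact: csn.
rewrite [RHS]integral_itv_bndoo; last first.
  apply/measurable_EFinP; apply: open_continuous_measurable_fun => //.
  move=> y /set_mem y01; apply: cvgM; first exact: cvg_cst.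
  exact: continuous_momentK.
have := @ge0_integration_by_substitution_oo _ F dF (fun t => sn t `^ a) 0 1 ltr01
  cF is_derive_F cdF dF0.
rewrite F0 F1 => /(_ csn) -> //; last by move=> t _; exact: powR_ge0.
apply: eq_integral => y /set_mem y01; congr (_%:E).
have y0 : 0 < y by rewrite (itvP y01).
rewrite /F ellHK; last exact/gcc/subset_itv_oo_cc.
(* Here $(y^{1/s})^q = y^{q/s}$ and $k^q = (k^s)^{q/s}$, which is how the modulus becomes $k^s$. *)
rewrite /dF; have -> : f (g y) = integrandK p (q / s) r (k `^ s) y.
  rewrite /integrandK /g -!powRrM.
  by rewrite [1 / s]div1r [s^-1 * q]mulrC [s * _]mulrC divfK ?gt_eqF.
rewrite /g -powRrM /momentK -[in RHS]powR_mulrn ?powR_ge0// -powRrM.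
(* The Jacobian exponent $1/s - 1$ cancels the part $(s-1)/s$ of the exponent from the power of
   [sn]. *)
rewrite (_ : q / s * n%:R = 1 / s * a + (1 / s - 1)); last first.
  by rewrite /a; field; rewrite gt_eqF.
rewrite (@powRD _ y (1 / s * a)); last by rewrite (gt_eqF y0) implybT.
by rewrite [1 / s]div1r; ring.
Qed.

End sn_integral.

(** The exponent $R$ of the formula is [rho] here. Equality in the extended reals makes convergence
    of the integral part of the claim. *)
Theorem theorem4p10 (R : realType) (p q r k : R) (n : nat) (rho u : R)
  (hp : 1 < p) (hq : 1 < q) (hr : 1 < r)
  (hk0 : 0 < k) (hk1 : k < 1)
  (hrho_gt : -1 < rho) (hrho_le : rho <= q - 1)
  (hu : 1 / u = (rho + 1) / q) :
  (\int[@lebesgue_measure R]_(t in `[0%R, ellK p q r k])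
      (ellsn p q r t k `^ (q * n%:R + rho))%:E
   = (1 / ((rho + 1) * pochhammer (1 / conj_exponent p + 1 / u + 1 / r) n)
      * (((matW p q r u k n 1 0 + k `^ q * matW p q r u k n 1 1)
            * ellK p u r (k `^ (rho + 1))
          - matW p q r u k n 1 0 * ellE p u r (k `^ (rho + 1)))
         / k `^ (q * n.+1%:R)))%:E)%E.
Proof.
set s := rho + 1.
have s0 : 0 < s by rewrite /s; lra.
have q0 : 0 < q by exact: lt_trans hq.
have sq : s <= q by rewrite /s; lra.
have -> : u = q / s by rewrite -[u]invrK -[u^-1]div1r hu invf_div.
have -> : rho = s - 1 by rewrite /s; ring.
rewrite integral_ellsn_powR//; congr (_%:E).
have hv : 1 <= q / s by rewrite ler_pdivlMr// mul1r.
have ks0 : 0 < k `^ s by rewrite powR_gt0.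
have ks1 : k `^ s < 1.
  rewrite -[ltRHS](_ : 1 `^ s = 1); last by rewrite powR1.
  by apply: (gt0_ltr_powR s0); rewrite ?nnegrE ?ltW.
have ksq : (k `^ s) `^ (q / s) = k `^ q by rewrite -powRrM mulrC divfK ?gt_eqF.
have conjE : 1 / conj_exponent p = 1 - 1 / p.
  by rewrite /conj_exponent; field; rewrite !gt_eqF ?subr_gt0// (lt_trans _ hp).
rewrite ellK_moment ellE_moment// ksq.
pose J := integralK p (q / s) r (k `^ s).
set c := 1 / conj_exponent p + 1 / (q / s) + 1 / r.
(* The bottom row of [matW] yields $J_n$ from $J_1$ and $J_0$. *)
have := @matW_recurrence R p q r (q / s) k J _ n 1.
rewrite -/c addn0 => matWJ.
have c0 : 0 < c.
  have p1 : 0 < 1 - 1 / p by rewrite subr_gt0 ltr_pdivrMr ?mul1r// (lt_trans _ hp).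
  have r1 : 0 < 1 / r by rewrite divr_gt0// (lt_trans _ hr).
  have v1 : 0 < 1 / (q / s) by rewrite !divr_gt0.
  by rewrite /c conjE addr_gt0// addr_gt0.
have P0 : pochhammer c n != 0.
  by rewrite gt_eqF// prodr_gt0// => i _; rewrite ltr_wpDr.
have K0 : k `^ q != 0 by rewrite gt_eqF// powR_gt0.
have -> : k `^ (q * n.+1%:R) = (k `^ q) ^+ n * k `^ q.
  by rewrite powRrM powR_mulrn ?powR_ge0// exprSr.
rewrite -!/(J _); set w0 := matW _ _ _ _ _ _ _ 0; set w1 := matW _ _ _ _ _ _ _ 1.
(* Substituting $K = J_0$ and $E = J_0 - k^q J_1$ cancels the terms $w_{2,1} J_0$; the factor $k^q$
   left over lowers the denominator $k^{q(n+1)}$ to $k^{qn}$. *)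
rewrite (_ : _ - _ = k `^ q * (w0 * J 1%N + w1 * J 0%N)); last by ring.
rewrite matWJ.
  by field; rewrite K0 P0 (gt_eqF s0) expf_neq0.
by move=> m; have := integralK_rec hp hv hr ks0 ks1 m; rewrite ksq -conjE -!/(J _) /c => <-; ring.
Qed.
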